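(* Let $\Delta\subset\mathbb R^3$ be an arbitrary nondegenerate convex lattice polytope. Then there is a function $r(d)=o(d^3)$ as $d\to\infty$ (depending on $\Delta$) such that for every integer $d\ge 1$ there exists a generic pencil of real surfaces in $(\mathbb C^* )^3$ with Newton polytope $d\Delta$ that contains at least $\frac{3}{2}\alpha(\Delta)^3d^3+r(d)$ real singular surfaces.
   Context: ''Nondegenerate'' means three-dimensional. $\Delta^3_1=\mathrm{Conv}\{(0,0,0),(1,0,0),(0,1,0),(0,0,1)\}$, and $$\alpha(\Delta)=\max\{\lambda>0 : \text{there exist } M\in GL(3,\mathbb Z)\text{ and } v\in\mathbb R^3 \text{ such that } \lambda M\Delta^3_1+v\subset\Delta\}.$$ Surfaces in $(\mathbb C^* )^3$ with Newton polytope $d\Delta$ are considered as members of the linear system of nonzero Laurent polynomials in three variables with support in $d\Delta$, up to scalar. A surface is called singular if it has a singular point in $(\mathbb C^* )^3$. A real pencil is a line, defined over $\mathbb R$, in this projective space; a real surface is one defined by a polynomial with real coefficients. A pencil is called generic if it contains only finitely many surfaces with a singularity in the big torus $(\mathbb C^* )^3$. *)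

(* Defs.v *)
From HB Require Import structures.
From mathcomp Require Import all_boot all_order all_algebra finmap.
From mathcomp Require Import all_classical all_reals all_analysis.
From mathcomp Require Import convex.
From mathcomp Require Import complex.
From mathcomp Require Import freeg.

Set Implicit Arguments.
Unset Strict Implicit.
Unset Printing Implicit Defensive.

Import Order.TTheory GRing.Theory Num.Theory.
Import numFieldNormedType.Exports.

Local Open Scope classical_set_scope.
Local Open Scope ring_scope.

Section Polytopes.
Variable R : realType.
Implicit Types A : set 'cV[R]_3.

Definition convex_hull A : set 'cV[R]_3 :=
  smallest (@convex_set R 'cV[R]_3) A.

Definition lattice_point (m : 'cV[int]_3) : 'cV[R]_3 := map_mx intr m.

Definition lattice_polytope A :=
  exists V : seq 'cV[int]_3, A = convex_hull [set lattice_point m | m in [set` V]].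

(* A has four affinely independent points. *)
Definition three_dimensional A :=
  exists p : 'I_4 -> 'cV[R]_3, (forall k, A (p k)) /\
    row_free (\matrix_(k < 3) (p (fintype.lift ord0 k) - p ord0)^T).

Definition dilate (d : nat) A : set 'cV[R]_3 := [set d%:R *: x | x in A].

Definition std_simplex : set 'cV[R]_3 :=
  convex_hull ([set 0] `|` [set delta_mx k 0 | k in [set: 'I_3]]).

(* The supremum is attained when A is a three-dimensional polytope, because A is
   compact and a lower bound on the scaling factor leaves finitely many M. *)
Definition alpha A : R :=
  sup [set lambda | 0 < lambda /\ exists (M : 'M[int]_3) (v : 'cV[R]_3),
    M \in unitmx /\
    [set lambda *: (map_mx intr M *m x) + v | x in std_simplex] `<=` A].

End Polytopes.

Section Surfaces.
Variable R : realType.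

(* The key of a term is its exponent vector. *)
Definition laurent := {freeg 'cV[int]_3 / R[i]}.
Implicit Types (f g P Q : laurent) (A : set 'cV[R]_3).

Definition torus : set 'cV[R[i]]_3 := [set x | forall k, x k 0 != 0].

Definition laurent_eval f (x : 'cV[R[i]]_3) : R[i] :=
  \sum_(m <- dom f) coeff m f * \prod_k x k 0 ^ m k 0.

Definition laurent_deriv (k : 'I_3) f : laurent :=
  \sum_(m <- dom f) << coeff m f * (m k 0)%:~R *g m - delta_mx k 0 >>.

Definition singular_poly f :=
  exists x, [/\ torus x, laurent_eval f x = 0
              & forall k, laurent_eval (laurent_deriv k f) x = 0].

Definition supported A f := forall m, m \in dom f -> A (lattice_point R m).

Definition real_poly f := forall m, coeff m f \is Num.real.

(* A surface is a class of nonzero Laurent polynomials up to scalar: it keeps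
   multiplicities, and it is not determined by the zero locus in the torus. *)
Definition surface f : set laurent := [set c *: f | c in [set c | c != 0]].

Definition singular_surface (S : set laurent) := exists2 f, S f & singular_poly f.

Definition real_surface (S : set laurent) := exists2 f, S f & real_poly f.

Definition lin_indep P Q :=
  forall a b : R[i], a *: P + b *: Q = 0 -> a = 0 /\ b = 0.

Definition pencil P Q : set (set laurent) :=
  [set S | exists a b : R[i], (a, b) != 0 /\ S = surface (a *: P + b *: Q)].

(* A line of the linear system is defined over the reals when the plane of
   polynomials above it has a basis of real polynomials. *)
Definition real_pencil A (L : set (set laurent)) :=
  exists P Q, [/\ supported A P /\ supported A Q, real_poly P /\ real_poly Q,
                  lin_indep P Q & L = pencil P Q].

Definition generic_pencil (L : set (set laurent)) :=
  finite_set (L `&` [set S | singular_surface S]).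

End Surfaces.

(* Main.v *)
Require Import Defs.
From HB Require Import structures.
From mathcomp Require Import all_boot all_order all_algebra.
From mathcomp Require Import all_classical all_reals all_analysis.
From mathcomp Require Import convex complex freeg separable ring lra zify.
Import Order.TTheory GRing.Theory Num.Theory.
Import numFieldNormedType.Exports.

(** The pencil is [A(x) + B(y) + D(z) - t q(x)], carried into a dilate of [Delta]
    by an affine unimodular change of exponents.  Its singular parameters are the
    critical values of [(A + c) / q], for [c] a sum of a critical value of [B] and
    one of [D].  With [q] the product of [X - i] for [1 <= i <= n] and
    [A = X q + delta^2 q'], each pole [i] contributes for small [c] two real
    critical values, close to [i + 2 delta] and [i - 2 delta] and strictly
    monotone in [c]; with [n ^ 2] distinct values of [c] this makes [2 n ^ 3] real
    singular members of degree [n + 1].  As [2 > 3 / 2], one may lose a constant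
    factor in [n ~ alpha d], and nothing remains to prove for small [d]. *)

Local Open Scope classical_set_scope.
Local Open Scope ring_scope.

Set Implicit Arguments.
Unset Strict Implicit.
Unset Printing Implicit Defensive.

(** The factor [q] is what beats [3 / 2]. With a constant in its place, [A], [B] and [D] of degree
    [n + 1] have at most [n] critical points each, and the pencil at most [n ^ 3] singular
    parameters. With [q] of degree [n], the critical points in [x] are zeros of the numerator
    [A' q - (A + c) q'], of degree [2 n]. The obstacle is to have all these points real and nonzero,
    with values that can be told apart. The choice of [A] makes [A / q] equal to [x] plus [delta^2]
    times the sum of the [1 / (x - i)]. Each pole then keeps its critical values within [1 / 2] of
    itself, one on either side, so that a value reveals its pole and its side, and monotonicity
    reveals [c]. The critical points arise as extrema on compact intervals: nothing is solved
    explicitly or followed continuously in [c]. Genericity is a separate, complex matter: the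
    numerator must be nonzero for every complex [c], and [t] must be determined also at the zeros of
    [q]. *)

(** * Laurent polynomials, singular points and monomial changes of coordinates *)

Section LaurentSums.
Variable R : realType.
Local Notation C := R[i].
Implicit Types (f g : laurent R) (phi : 'cV[int]_3 -> C) (x : 'cV[C]_3).

(** Evaluations, logarithmic derivatives and coefficients all have this form, for suitable [phi], so
    linearity and the effect of a change of exponents are proved once for all of them. *)
Definition laurent_sum phi f : C := \sum_(m <- dom f) coeff m f * phi m.

Lemma laurent_sum_lift phi f : laurent_sum phi f = fglift (phi : _ -> C^o) f.
Proof.
have fB := @lift_is_additive _ _ C^o phi.
have f0 : fglift (phi : _ -> C^o) 0 = 0 by rewrite -(subr0 0) fB subrr.
have fN g : fglift (phi : _ -> C^o) (- g) = - fglift (phi : _ -> C^o) g.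
  by rewrite -[- g]sub0r fB f0 sub0r.
have fD : {morph fglift (phi : _ -> C^o) : g h / g + h}.
  by move=> g h; rewrite -{1}[h]opprK fB fN opprK.
rewrite -{2}(freeg_sumE f) (big_morph _ fD f0).
by apply: eq_bigr => m _; rewrite liftU.
Qed.

Lemma laurent_sumU phi c m : laurent_sum phi << c *g m >> = c * phi m.
Proof. by rewrite laurent_sum_lift liftU. Qed.

Lemma laurent_sumB phi f g :
  laurent_sum phi (f - g) = laurent_sum phi f - laurent_sum phi g.
Proof. by rewrite !laurent_sum_lift; apply: (@lift_is_additive _ _ C^o). Qed.

HB.instance Definition _ phi := GRing.isZmodMorphism.Build (laurent R) C
  (laurent_sum phi) (laurent_sumB phi).

Lemma laurent_sumZ phi c f : laurent_sum phi (c *: f) = c * laurent_sum phi f.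
Proof.
rewrite -{1}(freeg_sumE f) scaler_sumr raddf_sum /= big_distrr /=.
apply: eq_bigr => m _.
suff -> : c *: << coeff m f *g m >> = << (c * coeff m f) *g m >> :> laurent R.
  by rewrite laurent_sumU mulrA.
by apply/eqP/freeg_eqP => z; rewrite coeffZ !coeffU mulrA.
Qed.

Definition monomial x (m : 'cV[int]_3) : C := \prod_k x k 0 ^ m k 0.

Lemma laurent_eval_sum f x : laurent_eval f x = laurent_sum (monomial x) f.
Proof. by []. Qed.

Lemma monomialD x m m' : torus x ->
  monomial x (m + m') = monomial x m * monomial x m'.
Proof.
move=> xT; rewrite /monomial -big_split /=.
by apply: eq_bigr => k _; rewrite mxE expfzDr ?xT.
Qed.

Lemma monomial_delta x k : monomial x (delta_mx k 0) = x k 0.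
Proof.
rewrite /monomial (bigD1 k) //= mxE !eqxx expr1z big1 ?mulr1 // => j /negbTE jk.
by rewrite mxE jk expr0z.
Qed.

Lemma mulr_laurent_deriv k f x : torus x ->
  x k 0 * laurent_eval (laurent_deriv k f) x =
  laurent_sum (fun m => (m k 0)%:~R * monomial x m) f.
Proof.
move=> xT; rewrite laurent_eval_sum /laurent_deriv raddf_sum /= big_distrr /=.
apply: eq_bigr => m _; rewrite laurent_sumU.
have -> : monomial x m = x k 0 * monomial x (m - delta_mx k 0).
  rewrite -{1}(monomial_delta x k) -monomialD //.
  by rewrite addrC subrK.
by rewrite mulrCA -mulrA; congr (_ * _); rewrite mulrCA.
Qed.

(** On the torus a partial derivative may be multiplied by its coordinate. The resulting logarithmic
    derivative keeps the exponents, which suits changes of exponents. *)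
Lemma singular_polyP f : singular_poly f <->
  exists x, [/\ torus x, laurent_sum (monomial x) f = 0 &
    forall k, laurent_sum (fun m => (m k 0)%:~R * monomial x m) f = 0].
Proof.
split=> -[x [xT fx dfx]]; exists x; split=> // k.
  by rewrite -mulr_laurent_deriv // dfx mulr0.
by apply/(mulfI (xT k)); rewrite mulr_laurent_deriv // dfx mulr0.
Qed.

Definition reindex_laurent (h : 'cV[int]_3 -> 'cV[int]_3) f : laurent R :=
  \sum_(m <- dom f) << coeff m f *g h m >>.

Lemma laurent_sum_reindex phi h f :
  laurent_sum phi (reindex_laurent h f) = laurent_sum (phi \o h) f.
Proof.
rewrite /reindex_laurent raddf_sum /=.
by apply: eq_bigr => m _; rewrite laurent_sumU.
Qed.

Lemma coeff_laurent_sum m f :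
  coeff m f = laurent_sum (fun y => (y == m)%:R) f.
Proof. by rewrite laurent_sum_lift. Qed.

Lemma laurent_sum_inj f g :
  (forall phi, laurent_sum phi f = laurent_sum phi g) -> f = g.
Proof.
by move=> fg; apply/eqP/freeg_eqP => m; rewrite !coeff_laurent_sum fg.
Qed.

Lemma eq_laurent_sum phi psi f : phi =1 psi ->
  laurent_sum phi f = laurent_sum psi f.
Proof. by move=> e; apply: eq_bigr => m _; rewrite e. Qed.

Lemma laurent_sumDl phi psi f :
  laurent_sum (fun m => phi m + psi m) f = laurent_sum phi f + laurent_sum psi f.
Proof. by rewrite -big_split; apply: eq_bigr => m _; rewrite mulrDr. Qed.

Lemma laurent_sumZl c phi f :
  laurent_sum (fun m => c * phi m) f = c * laurent_sum phi f.
Proof. by rewrite big_distrr; apply: eq_bigr => m _; rewrite /= mulrCA. Qed.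

Lemma laurent_sum_suml (I : Type) (r : seq I) (phi : I -> _) f :
  laurent_sum (fun m => \sum_(i <- r) phi i m) f =
  \sum_(i <- r) laurent_sum (phi i) f.
Proof. by rewrite exchange_big; apply: eq_bigr => m _; rewrite /= big_distrr. Qed.

Lemma reindex_laurent_is_linear h : linear (reindex_laurent h).
Proof.
move=> c f g; apply: laurent_sum_inj => phi.
by rewrite laurent_sum_reindex !raddfD /= !laurent_sumZ !laurent_sum_reindex.
Qed.

HB.instance Definition _ h := GRing.isLinear.Build C (laurent R) (laurent R) _
  (reindex_laurent h) (reindex_laurent_is_linear h).

Lemma reindex_laurentK h h' : cancel h h' ->
  cancel (reindex_laurent h) (reindex_laurent h').
Proof.
move=> hK f; apply: laurent_sum_inj => phi; rewrite !laurent_sum_reindex.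
by apply: eq_laurent_sum => m; rewrite /= hK.
Qed.

Lemma dom_reindex_laurent h f m :
  m \in dom (reindex_laurent h f) -> exists2 m', m' \in dom f & m = h m'.
Proof.
rewrite mem_dom coeff_laurent_sum laurent_sum_reindex => /eqP H.
apply: contrapT => nm; apply: H; rewrite /laurent_sum big1_seq // => m' /andP[_ mf].
by rewrite /=; case: eqP => [e|_]; [case: nm; exists m' | rewrite mulr0].
Qed.

Lemma real_reindex_laurent h f : real_poly f -> real_poly (reindex_laurent h f).
Proof.
move=> fr m; rewrite coeff_laurent_sum laurent_sum_reindex.
by apply: rpred_sum => m' _; rewrite rpredM // realn.
Qed.

(* The map of the torus dual to the map [M] of exponents. *)
Definition torus_map (M : 'M[int]_3) x : 'cV[C]_3 :=
  \col_l monomial x (col l M).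

Lemma torus_torus_map M x : torus x -> torus (torus_map M x).
Proof.
by move=> xT l; rewrite mxE; apply/prodf_neq0 => k _; rewrite expfz_neq0 ?xT.
Qed.

Lemma monomial_neq0 x m : torus x -> monomial x m != 0.
Proof. by move=> xT; apply/prodf_neq0 => k _; rewrite expfz_neq0 ?xT. Qed.

Lemma expfz_prod (I : Type) (r : seq I) (F : I -> C) z :
  (\prod_(i <- r) F i) ^ z = \prod_(i <- r) F i ^ z.
Proof.
by elim/big_rec2: _ => [|i y1 y2 _ <-]; rewrite ?exp1rz // expfzMl.
Qed.

Lemma monomial_torus_map M x m : torus x ->
  monomial (torus_map M x) m = monomial x (M *m m).
Proof.
move=> xT; rewrite /monomial.
under eq_bigr => l _ do rewrite mxE /monomial expfz_prod.
rewrite exchange_big /=; apply: eq_bigr => k _; rewrite mxE.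
rewrite (big_morph _ (_ : {morph (fun z => x k 0 ^ z) : a b / a + b >-> a * b})
  (expr0z _)); last by move=> a b; rewrite expfzDr ?xT.
by apply: eq_bigr => l _; rewrite mxE exprz_exp.
Qed.

Lemma torus_map_comp M N x : torus x ->
  torus_map M (torus_map N x) = torus_map (N *m M) x.
Proof.
move=> xT; apply/matrixP => l j; rewrite !mxE monomial_torus_map //.
by congr monomial; apply/matrixP => a b; rewrite !mxE; apply: eq_bigr => c _; rewrite !mxE.
Qed.

Lemma torus_map1 x : torus_map 1%:M x = x.
Proof.
apply/matrixP => l j; rewrite mxE ord1 /monomial (bigD1 l) //= !mxE eqxx expr1z.
by rewrite big1 ?mulr1 // => k /negbTE kl; rewrite !mxE kl expr0z.
Qed.

Definition affine_map (M : 'M[int]_3) (w m : 'cV[int]_3) := M *m m + w.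

Lemma affine_mapK M w : M \in unitmx ->
  cancel (affine_map M w) (affine_map (invmx M) (- (invmx M *m w))).
Proof. by move=> Mu m; rewrite /affine_map mulmxDr mulKmx // addrK. Qed.

(** By the chain rule the logarithmic derivatives are mixed linearly by [M]; the translation [w]
    only multiplies by a unit and adds a multiple of the value of [f], which is zero at the singular
    point. *)
Lemma singular_reindexW M w f : M \in unitmx ->
  singular_poly f -> singular_poly (reindex_laurent (affine_map M w) f).
Proof.
move=> Mu /singular_polyP[y [yT fy dfy]]; apply/singular_polyP.
pose x := torus_map (invmx M) y.
have xT : torus x by apply: torus_torus_map.
have mE m : monomial x (affine_map M w m) = monomial x w * monomial y m.
  rewrite /affine_map monomialD // mulrC -monomial_torus_map //.
  by rewrite torus_map_comp // mulVmx // torus_map1.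
exists x; split=> //.
  by rewrite laurent_sum_reindex (eq_laurent_sum _ mE) laurent_sumZl fy mulr0.
move=> k; rewrite laurent_sum_reindex.
rewrite (@eq_laurent_sum _ (fun m => monomial x w *
  ((w k 0)%:~R * monomial y m + \sum_l (M k l)%:~R * ((m l 0)%:~R * monomial y m)))).
  rewrite laurent_sumZl laurent_sumDl laurent_sumZl fy laurent_sum_suml big1.
    by rewrite mulr0 addr0 mulr0.
  by move=> l _; rewrite laurent_sumZl dfy mulr0.
move=> m /=; rewrite mE mulrCA; congr (_ * _); rewrite !mxE rmorphD mulrDl addrC.
congr (_ + _); rewrite rmorph_sum /= mulr_suml; apply: eq_bigr => l _.
by rewrite rmorphM mulrA.
Qed.

Lemma singular_reindex M w f : M \in unitmx ->
  singular_poly (reindex_laurent (affine_map M w) f) <-> singular_poly f.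
Proof.
move=> Mu; split; last exact: singular_reindexW.
rewrite -{2}(reindex_laurentK (affine_mapK w Mu) f).
by apply: singular_reindexW; rewrite unitmx_inv.
Qed.

End LaurentSums.

(** * Sums of univariate polynomials in separate variables *)

Section SeparatedPolynomials.
Variable R : realType.
Local Notation C := R[i].
Implicit Types (p q : {poly C}) (k l : 'I_3) (x : 'cV[C]_3).

Definition axis_laurent k p : laurent R :=
  \sum_(i < size p) << p`_i *g delta_mx k 0 *+ i >>.

Lemma laurent_sum_axis (phi : 'cV[int]_3 -> C) k p :
  laurent_sum phi (axis_laurent k p) = \sum_(i < size p) p`_i * phi (delta_mx k 0 *+ i).
Proof. by rewrite raddf_sum; apply: eq_bigr => i _; rewrite /= laurent_sumU. Qed.

Lemma monomial_axis x k i : torus x -> monomial x (delta_mx k 0 *+ i) = x k 0 ^+ i.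
Proof.
move=> xT; elim: i => [|i IHi].
  by rewrite mulr0n /monomial big1 // => j _; rewrite mxE expr0z.
by rewrite mulrS monomialD // IHi monomial_delta exprS.
Qed.

Lemma eval_axis x k p : torus x ->
  laurent_sum (monomial x) (axis_laurent k p) = p.[x k 0].
Proof.
move=> xT; rewrite laurent_sum_axis horner_coef.
by apply: eq_bigr => i _; rewrite monomial_axis.
Qed.

Lemma log_deriv_axis x k l p : torus x ->
  laurent_sum (fun m => (m l 0)%:~R * monomial x m) (axis_laurent k p) =
  if l == k then x k 0 * p^`().[x k 0] else 0.
Proof.
move=> xT; rewrite laurent_sum_axis.
have -> : \sum_(i < size p) p`_i * (((delta_mx k 0 *+ i : 'cV[int]_3) l 0)%:~R *
    monomial x (delta_mx k 0 *+ i)) =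
    (l == k)%:R * \sum_(i < size p) (p`_i *+ i) * x k 0 ^+ i.
  rewrite big_distrr; apply: eq_bigr => i _ /=.
  rewrite monomial_axis // mulmxnE mxE andbT.
  rewrite rmorphMn /=; case: (l == k); last by rewrite mul0rn mul0r mulr0 mul0r.
  by rewrite mul1r mulrA mulr_natr.
case: (l == k); rewrite ?mul0r // mul1r.
rewrite -[p in p^`()]coefK poly_def linear_sum /= horner_sum mulr_sumr.
apply: eq_bigr => i _; rewrite derivZ derivXn hornerZ hornerMn hornerXn.
case: (i : nat) => [|j] /=; first by rewrite !mulr0n mul0r !mulr0.
by rewrite exprS; ring.
Qed.

Lemma dom_axis k p m : m \in dom (axis_laurent k p) ->
  exists2 i : nat, (i < size p)%N & m = delta_mx k 0 *+ i.
Proof.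
move=> /dom_sum_subset /flattenP[_ /mapP[i _ ->]].
case: (eqVneq p`_i 0) => [->|pi0]; first by rewrite freegU0 dom0.
by rewrite domU // inE => /eqP ->; exists i.
Qed.

Lemma real_axis k p : (forall i, p`_i \is Num.real) -> real_poly (axis_laurent k p).
Proof.
move=> pr m; rewrite coeff_laurent_sum laurent_sum_axis.
by apply: rpred_sum => i _; rewrite rpredM // realn.
Qed.

Definition separated (A B D : {poly C}) : laurent R :=
  axis_laurent 0 A + axis_laurent 1 B + axis_laurent 2 D.

Lemma singular_separatedP (A B D q : {poly C}) (a b : C) :
  singular_poly (a *: separated A B D + b *: axis_laurent 0 q) <->
  exists x y z : C, [/\ x != 0, y != 0 & z != 0] /\
    [/\ a * (A.[x] + B.[y] + D.[z]) + b * q.[x] = 0,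
        a * A^`().[x] + b * q^`().[x] = 0,
        a * B^`().[y] = 0 & a * D^`().[z] = 0].
Proof.
have sE phi : laurent_sum phi (a *: separated A B D + b *: axis_laurent 0 q) =
   a * (laurent_sum phi (axis_laurent 0 A) + laurent_sum phi (axis_laurent 1 B)
     + laurent_sum phi (axis_laurent 2 D)) + b * laurent_sum phi (axis_laurent 0 q).
  by rewrite raddfD /= !laurent_sumZ !raddfD.
split=> [/singular_polyP[v [vT v0 vk]]|[x [y [z [[x0 y0 z0] [e0 e1 e2 e3]]]]]].
  exists (v 0 0), (v 1 0), (v 2 0); split; first by split; apply: vT.
  move: v0; rewrite sE !eval_axis // => e0.
  have := vk 0; have := vk 1; have := vk 2.
  rewrite !sE !log_deriv_axis //= !(addr0, add0r, mulr0) => e3 e2 e1.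
  split=> //.
  - by apply: (mulfI (vT 0)); rewrite mulr0 -e1; ring.
  - by apply: (mulfI (vT 1)); rewrite mulr0 -e2; ring.
  - by apply: (mulfI (vT 2)); rewrite mulr0 -e3; ring.
pose v : 'cV[C]_3 := \col_k [:: x; y; z]`_k.
have [v0 v1 v2] : [/\ v 0 0 = x, v 1 0 = y & v 2 0 = z] by rewrite !mxE.
have vT : torus v by move=> k; rewrite mxE; case: k => -[|[|[|]]].
apply/singular_polyP; exists v; split=> //.
  by rewrite sE !eval_axis // v0 v1 v2.
move=> k; rewrite sE !log_deriv_axis // v0 v1 v2.
case: k => -[|[|[|//]]] lt3 /=; rewrite !(addr0, add0r, mulr0) mulrCA ?e2 ?e3 ?mulr0 //.
by rewrite [b * _]mulrCA -mulrDr e1 mulr0.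
Qed.

End SeparatedPolynomials.

(** * Convex hulls, and lattice simplices inside dilates *)

Section Polytope.
Variable R : realType.
Implicit Types (A : set 'cV[R]_3) (x y : 'cV[R]_3).

Lemma convex_setP A : convex_set (A : set (convex_lmodType 'cV[R]_3)) <->
  forall x y (l : R), 0 <= l -> l <= 1 -> A x -> A y -> A (l *: x + (1 - l) *: y).
Proof.
split=> [cA x y l l0 l1 Ax Ay|cA x y l]; last first.
  rewrite !inE => Ax Ay; rewrite /conv /=.
  exact: cA.
have l01 : 0 <= l <= 1 by rewrite l0.
have := cA x y (Itv01 l0 l1); rewrite !inE => /(_ Ax Ay).
by rewrite /conv /=.
Qed.

Lemma convex_hull_le A (K : set 'cV[R]_3) :
  convex_set (K : set (convex_lmodType 'cV[R]_3)) -> A `<=` K -> convex_hull A `<=` K.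
Proof. by move=> cK AK; apply: smallest_sub. Qed.

Lemma sub_convex_hull A : A `<=` convex_hull A.
Proof. exact: sub_smallest. Qed.

(** The weight missing from [1] goes to the point [0]. The induction normalizes the tail by
    [1 - c i]; the case [c i = 1] is apart because all later weights then vanish. *)
Lemma convex_comb_seq (K : set 'cV[R]_3) (I : Type) (r : seq I)
    (p : I -> 'cV[R]_3) (c : I -> R) :
  convex_set (K : set (convex_lmodType 'cV[R]_3)) -> K 0 -> (forall i, K (p i)) ->
  (forall i, 0 <= c i) -> \sum_(i <- r) c i <= 1 -> K (\sum_(i <- r) c i *: p i).
Proof.
move=> /convex_setP cK K0 Kp c0.
elim: r c c0 => [|i r IHr] c c0; first by rewrite !big_nil.
rewrite !big_cons => cr.
have r0 : 0 <= \sum_(j <- r) c j by apply: sumr_ge0.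
have ci1 : c i <= 1 by lra.
have [ci_lt1|] := ltP (c i) 1; last first.
  move=> ci_ge1; have ci : c i = 1 by lra.
  have cr0 : \sum_(j <- r) c j = 0 by lra.
  have := cK (p i) 0 1; rewrite ler01 lexx => /(_ isT isT (Kp i) K0).
  rewrite subrr scaler0 addr0 => Kpi.
  suff -> : \sum_(j <- r) c j *: p j = 0 by rewrite addr0 ci.
  clear -cr0 c0; elim: r cr0 => [|j r IHr]; first by rewrite !big_nil.
  rewrite !big_cons => e.
  have r0 : 0 <= \sum_(j <- r) c j by apply: sumr_ge0.
  have cj := c0 j; rewrite (_ : c j = 0) ?scale0r ?add0r; last by lra.
  by apply: IHr; lra.
have s0 : 0 < 1 - c i by lra.
have := IHr (fun j => c j / (1 - c i)); rewrite -mulr_suml ler_pdivrMr // mul1r.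
move=> /(_ (fun j => divr_ge0 (c0 j) (ltW s0))) Kr.
have {}Kr := Kr ltac:(lra).
have := cK (p i) _ (c i) (c0 i) ci1 (Kp i) Kr; rewrite scaler_sumr.
suff -> : \sum_(j <- r) (1 - c i) *: ((c j / (1 - c i)) *: p j) = \sum_(j <- r) c j *: p j.
  by [].
by apply: eq_bigr => j _; rewrite scalerA mulrC divfK // gt_eqF.
Qed.

Lemma std_simplexW x : (forall k, 0 <= x k 0) -> \sum_k x k 0 <= 1 -> std_simplex x.
Proof.
move=> x0 x1; rewrite (_ : x = \sum_k x k 0 *: delta_mx k 0); last first.
  by rewrite {1}[x]matrix_sum_delta; apply: eq_bigr => k _; rewrite big_ord1.
have cs : convex_set (@std_simplex R : set (convex_lmodType 'cV[R]_3)).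
  by apply/convex_setP => a b l l0 l1 Ka Kb S [cS AS];
    move/convex_setP: (cS); apply=> //; [apply: Ka | apply: Kb].
apply: convex_comb_seq => //.
- by apply: sub_convex_hull; left.
- by move=> k; apply: sub_convex_hull; right; exists k.
Qed.

Lemma lattice_pointMn m d : lattice_point R (m *+ d) = d%:R *: lattice_point R m.
Proof. by rewrite /lattice_point raddfMn scaler_nat. Qed.

(** These give the two monomials of the pencil used for small [d]. With a single lattice point the
    hull would be a point and all differences [p k - p 0] would vanish. *)
Lemma two_lattice_points (Delta : set 'cV[R]_3) :
  lattice_polytope Delta -> three_dimensional Delta ->
  exists m m' : 'cV[int]_3, [/\ m != m', Delta (lattice_point R m) & Delta (lattice_point R m')].
Proof.
move=> [V DV] [p [Dp pfree]].
have sV m : m \in V -> Delta (lattice_point R m).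
  by move=> mV; rewrite DV; apply: sub_convex_hull; exists m.
apply: contrapT => nmm.
suff [x Dx] : exists x, Delta `<=` [set x].
  move: pfree; rewrite (_ : \matrix_k _ = 0) ?/row_free ?mxrank0 //.
  by apply/row_matrixP => k; rewrite rowK row0 (Dx _ (Dp _)) (Dx _ (Dp ord0)) subrr trmx0.
have c1 x : convex_set ([set x] : set (convex_lmodType 'cV[R]_3)).
  by apply/convex_setP => a b l _ _ -> -> /=; rewrite -scalerDl subrKC scale1r.
have [m0 Vm0] : exists m0, forall m, m \in V -> m = m0.
  case: V {DV} sV => [|m0 V] sV; first by exists 0.
  exists m0 => m mV; apply/eqP/negPn/negP => mm0; apply: nmm.
  by exists m, m0; split=> //; apply: sV; rewrite ?mem_head.
exists (lattice_point R m0); rewrite DV; apply: convex_hull_le => // _ [m mV <-].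
by rewrite (Vm0 m).
Qed.

(** Pulled back by [M], the dilate contains a standard simplex of size [d * lambda] with corner [u].
    Rounding [u] up to the lattice costs less than [1] in each coordinate, hence the [3]. *)
Lemma dilated_lattice_simplex (Delta : set 'cV[R]_3) (lambda : R)
    (M : 'M[int]_3) (v : 'cV[R]_3) (d e : nat) :
  M \in unitmx -> 0 < lambda ->
  [set lambda *: (map_mx intr M *m x) + v | x in @std_simplex R] `<=` Delta ->
  (0 < d)%N -> e%:R + 3 <= d%:R * lambda ->
  exists w, forall m : 'cV[int]_3, (forall k, 0 <= m k 0) -> \sum_k m k 0 <= e%:Z ->
    dilate d Delta (lattice_point R (affine_map M w m)).
Proof.
move=> Mu l0 sD d0 ed.
pose MR : 'M[R]_3 := map_mx intr M.
have MRu : MR \in unitmx by rewrite unitmxE det_map_mx rmorph_unit // -unitmxE.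
pose u : 'cV[R]_3 := d%:R *: (invmx MR *m v).
pose w : 'cV[int]_3 := \col_k Num.ceil (u k 0).
exists (M *m w) => m m0 me.
pose x := (d%:R * lambda)^-1 *: (lattice_point R (m + w) - u).
have dR : 0 < d%:R :> R by rewrite ltr0n.
have dl0 : 0 < d%:R * lambda by rewrite mulr_gt0.
exists (lambda *: (MR *m x) + v).
  apply: sD; exists x => //; apply: std_simplexW.
    move=> k; rewrite !mxE mulr_ge0 ?invr_ge0 ?(ltW dl0) // rmorphD /=.
    have := ceil_ge (d%:R * (invmx MR *m v) k 0).
    have : 0 <= (m k 0)%:~R :> R by rewrite ler0z.
    rewrite !mxE; lra.
  under eq_bigr => k _ do rewrite mxE.
  rewrite -mulr_sumr mulrC ler_pdivrMr // mul1r.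
  apply: le_trans ed; rewrite (le_trans (_ : _ <= \sum_(k < 3) ((m k 0)%:~R + 1))) //.
    apply: ler_sum => k _; rewrite !mxE rmorphD /=.
    have := ceilB1_lt (d%:R * (invmx MR *m v) k 0); rewrite !mxE; lra.
  rewrite big_split /= sumr_const card_ord lerD2r.
  by rewrite -rmorph_sum /= -[e%:R]/(e%:Z%:~R) ler_int.
rewrite scalerDr scalerA -scalemxAr scalerA mulfV ?gt_eqF // scale1r.
rewrite mulmxBr -scalemxAr mulKVmx // subrK.
by rewrite /affine_map -mulmxDr /lattice_point map_mxM.
Qed.

End Polytope.

(** * Polynomials with distinct critical values, by generic choices *)

Section CriticalPoints.
Variable R : realType.
Implicit Types (p q : {poly R}).

Lemma pos_nonroot p : p != 0 -> exists2 x : R, 0 < x & p.[x] != 0.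
Proof.
move=> p0; apply: contrapT => np.
pose s := [seq k.+1%:R : R | k <- iota 0 (size p)].
have ps : all (root p) s.
  apply/allP => _ /mapP[k _ ->]; apply/negPn/negP => pk; apply: np.
  by exists k.+1%:R; rewrite ?ltr0n.
have us : uniq s.
  rewrite map_inj_uniq ?iota_uniq // => j k /eqP.
  by rewrite eqr_nat eqSS => /eqP.
by have := max_poly_roots p0 ps us; rewrite size_map size_iota ltnn.
Qed.

Lemma poly_primitive p : exists2 P : {poly R}, P^`() = p & (size P <= (size p).+1)%N.
Proof.
exists (\poly_(i < (size p).+1) (p`_i.-1 / i%:R)); last exact: size_poly.
apply/polyP => i; rewrite coef_deriv coef_poly ltnS /= -[LHS]mulr_natr.
case: ltnP => [_|pi]; first by rewrite divfK // pnatr_eq0.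
by rewrite mul0r nth_default.
Qed.

(* The step replaces [B] by a primitive of [(r - 'X) * B^`()]: the critical
   values are then nonconstant polynomials in [r], distinct for generic [r]. *)
Lemma distinct_positive_critical_values n : exists (B : {poly R}) (y : nat -> R),
  [/\ (size B <= n.+2)%N, B^`() != 0,
      forall i, (i < n)%N -> 0 < y i /\ B^`().[y i] = 0
    & forall i j, (i < n)%N -> (j < n)%N -> B.[y i] = B.[y j] -> i = j].
Proof.
elim: n => [|n [B [y [sB B'0 yP y_inj]]]].
  by exists 'X, (fun=> 0); split=> //; rewrite ?size_polyX // derivX oner_neq0.
have [B1 B1E sB1] := poly_primitive ('X * B^`()).
(* As polynomials in [r], these are the differences of critical values of [r *: B - B1]: between
   [y i] and [y j] for [d i j], between the new point [r] and [y i] for [e i]. *)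
pose d i j : {poly R} := (B.[y i] - B.[y j]) *: 'X - (B1.[y i] - B1.[y j])%:P.
pose e i : {poly R} := 'X * B - B1 - B.[y i] *: 'X + B1.[y i]%:P.
pose g := (\prod_(i < n) e i) * \prod_(ij : 'I_n * 'I_n | ij.1 != ij.2) d ij.1 ij.2.
have [r r0] : exists2 r : R, 0 < r & g.[r] != 0.
  apply: pos_nonroot; rewrite mulf_neq0 //; apply/prodf_neq0.
    (* The derivative of [e i] is [B - B.[y i]], and [B] is not constant. *)
    move=> i _; apply/eqP => /(congr1 (@deriv R)).
    rewrite /e !derivD !derivN derivM derivX derivZ derivX !derivC B1E mul1r.
    rewrite ?deriv0 addr0 addrK => /eqP; rewrite subr_eq0 => /eqP BE.
    by move: B'0; rewrite BE derivZ derivC scaler0 eqxx.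
  move=> [i j] /= ij; apply/eqP => /polyP/(_ 1%N).
  rewrite /d coefB coefZ coefX coefC mulr1 subr0 coef0 => /eqP.
  by rewrite subr_eq0 => /eqP/(y_inj _ _ (ltn_ord i) (ltn_ord j))/val_inj/eqP; apply/negP.
rewrite hornerM mulf_eq0 negb_or !horner_prod => /andP[/prodf_neq0 er /prodf_neq0 dr].
pose B2 := r *: B - B1.
have B2E : B2^`() = (r%:P - 'X) * B^`().
  by rewrite derivB derivZ B1E mulrBl mul_polyC.
have rX : r%:P - 'X != 0 :> {poly R} by rewrite -oppr_eq0 opprB polyXsubC_eq0.
have er' i : (i < n)%N -> B2.[r] != B2.[y i].
  move=> ilt; have := er (Ordinal ilt) isT; rewrite /e /B2 !hornerE /=.
  by apply: contra => /eqP E; rewrite -subr_eq0 in E *; apply/eqP; move: E; lra.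
exists B2, (fun i => if (i < n)%N then y i else r); split.
- rewrite (leq_trans (size_polyD _ _)) // geq_max size_polyN.
  rewrite (leq_trans (size_scale_leq _ _)) ?(leq_trans sB) //=.
  rewrite (leq_trans sB1) // ltnS mulrC (size_mulX B'0) ltnS.
  by rewrite -ltnS (leq_trans _ sB) // lt_size_deriv //; apply: contraNneq B'0 => ->; rewrite deriv0.
- by rewrite B2E mulf_neq0.
- move=> i _; rewrite B2E hornerM; case: ifP => [/yP[y0 ->]|_]; first by rewrite mulr0.
  by rewrite !hornerE subrr mul0r.
- move=> i j; rewrite !ltnS (leq_eqVlt i n) (leq_eqVlt j n).
  have nn : (n < n)%N = false by rewrite ltnn.
  move=> /predU1P[->|ilt] /predU1P[->|jlt]; rewrite ?nn ?ilt ?jlt // => E.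
  + by move: (er' _ jlt); rewrite E eqxx.
  + by move: (er' _ ilt); rewrite E eqxx.
  + apply/eqP/negPn/negP => ij.
    have := dr (Ordinal ilt, Ordinal jlt) ij; rewrite /d !hornerE /= => /eqP; apply.
    by move: E; rewrite /B2 !hornerE; lra.
Qed.

(** Take [D] proportional to [B] with a generic ratio [r]: the sums [v i + r * v j] are then
    pairwise distinct. A common factor [s] shrinks them below [eta] and keeps them distinct. *)
Lemma small_distinct_critical_sums n (eta : R) : 0 < eta ->
  exists (B D : {poly R}) (y z : nat -> R),
  [/\ (size B <= n.+2)%N /\ (size D <= n.+2)%N, B^`() != 0 /\ D^`() != 0,
      forall i, (i < n)%N -> [/\ 0 < y i, B^`().[y i] = 0, 0 < z i & D^`().[z i] = 0],
      forall i j, (i < n)%N -> (j < n)%N -> `|B.[y i] + D.[z j]| <= eta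
    & forall i j k l, (i < n)%N -> (j < n)%N -> (k < n)%N -> (l < n)%N ->
        B.[y i] + D.[z j] = B.[y k] + D.[z l] -> i = k /\ j = l].
Proof.
move=> eta0; have [B [y [sB B'0 yP y_inj]]] := distinct_positive_critical_values n.
pose v i := B.[y i].
pose d i j k l : {poly R} := (v j - v l) *: 'X + (v i - v k)%:P.
pose g := \prod_(u : ('I_n * 'I_n) * ('I_n * 'I_n) | u.1.2 != u.2.2)
  d u.1.1 u.1.2 u.2.1 u.2.2.
have [r r0] : exists2 r : R, 0 < r & g.[r] != 0.
  apply/pos_nonroot/prodf_neq0 => -[[i j] [k l]] /= jl; apply/eqP => /polyP/(_ 1%N).
  rewrite /d coefD coefZ coefX coefC mulr1 addr0 coef0 => /eqP; rewrite subr_eq0.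
  by move=> /eqP/(y_inj _ _ (ltn_ord j) (ltn_ord l))/val_inj/eqP; apply/negP.
rewrite horner_prod => /prodf_neq0 gr.
pose S := \sum_(u : 'I_n * 'I_n) `|v u.1 + r * v u.2|.
have S0 : 0 <= S by apply: sumr_ge0.
(* [S] dominates every [v i + r * v j] in absolute value; the [1] keeps the denominator positive. *)
pose s := eta / (1 + S).
have s0 : 0 < s by rewrite divr_gt0 // ltr_pwDl.
have sr0 : 0 < s * r by rewrite mulr_gt0.
exists (s *: B), ((s * r) *: B), y, y; split.
- by rewrite (size_scale _ (lt0r_neq0 s0)) (size_scale _ (lt0r_neq0 sr0)).
- by split; rewrite derivZ scaler_eq0 negb_or B'0 lt0r_neq0.
- by move=> i /yP[? e]; rewrite !derivZ !hornerZ e !mulr0.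
- move=> i j ilt jlt; rewrite !hornerZ -(mulrA s r) -mulrDr normrM gtr0_norm //.
  rewrite /s mulrAC ler_pdivrMr ?ltr_pwDl // ler_pM2l //.
  rewrite /S (bigD1 (Ordinal ilt, Ordinal jlt)) //= addrCA lerDl addr_ge0 //.
  by apply: sumr_ge0.
- move=> i j k l il jl kl ll; rewrite !hornerZ -!(mulrA s r) -!mulrDr => /(mulfI (lt0r_neq0 s0)) E.
  have jl_eq : j = l.
    apply/eqP/negPn/negP => jl_neq.
    have := gr ((Ordinal il, Ordinal jl), (Ordinal kl, Ordinal ll)) jl_neq.
    by rewrite /d !hornerE /= => /eqP; apply; rewrite /v; move: E; lra.
  by split=> //; apply: y_inj => //; move: E; rewrite jl_eq => /addIr.
Qed.

Lemma lead_coef_deriv (F : numDomainType) (p : {poly F}) :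
  lead_coef p^`() = lead_coef p *+ (size p).-1.
Proof.
have [p_le1|p_gt1] := leqP (size p) 1.
  rewrite (size1_polyC p_le1) derivC lead_coef0.
  by case: (size _) (size_polyC_leq1 p`_0) => [|[|//]].
have k0 : (0 < (size p).-1)%N by case: (size p) p_gt1 => [|[]].
have -> : p^`() = \poly_(i < (size p).-1) (p`_i.+1 *+ i.+1) by [].
rewrite lead_coef_poly //; first by rewrite prednK.
by rewrite prednK // mulrn_eq0 -lead_coefE lead_coef_eq0 -size_poly_eq0; case: (size p) k0 => [|[|n]].
Qed.

(** The leading coefficients of the two products are that of [p * q] times the degree of [p],
    respectively of [q], and these degrees differ. *)
Lemma wronskian_neq0 (F : numDomainType) (p q : {poly F}) :
  p != 0 -> q != 0 -> size p != size q -> p^`() * q - p * q^`() != 0.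
Proof.
move=> p0 q0; apply: contraNneq => /subr0_eq/(congr1 lead_coef).
rewrite !lead_coefM !lead_coef_deriv mulrnAl mulrnAr -[LHS]mulr_natr -[RHS]mulr_natr.
move=> /mulfI/eqP; rewrite mulf_neq0 ?lead_coef_eq0 // eqr_nat => /(_ isT).
by move: p0 q0; rewrite -!size_poly_gt0; case: (size p) (size q) => [|a] [|b].
Qed.

End CriticalPoints.

(** * One branch of critical values on one side of a pole *)

Section CriticalValuesNearPoles.
Variable R : realType.
Implicit Types (p q r : {poly R}).

Lemma poly_local_min p (l u x : R) : l < x -> x < u ->
  (forall y, l < y -> y < u -> p.[x] <= p.[y]) -> p^`().[x] = 0.
Proof.
move=> lx xu xmin; have xI : x \in `]l, u[ by rewrite in_itv /= lx xu.
have dx : is_derive x 1 (horner p) 0.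
  apply: (derive1_at_min (ltW (lt_trans lx xu))) => // t.
  by rewrite in_itv /= => /andP[]; exact: xmin.
by rewrite derivE derive1E derive_val.
Qed.

(** Here [a] is the pole, [sg] the side on which it is approached, and [r] stands for the product of
    the other factors of [q]: bounded away from zero, of constant sign and with bounded logarithmic
    derivative near [a]. *)
Variables (a sg delta rho K : R) (r : {poly R}).
Hypothesis sg2 : sg * sg = 1.
Hypothesis rho0 : 0 < rho.
Hypothesis K1 : 1 <= K.
Hypothesis deltaE : delta = (8 * K)^-1.
Hypothesis rP : forall u : R, 0 <= u -> u <= 2^-1 -> [/\ rho <= `|r.[a + sg * u]|,
  0 < r.[a] * r.[a + sg * u] & `|r^`().[a + sg * u]| <= (K - 1) * `|r.[a + sg * u]|].

Let q := ('X - a%:P) * r.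
Let A := 'X * q + delta ^+ 2 *: q^`().

(* Since [A / q = x + delta^2 * q' / q], the value of [(A + c) / q] at [a + sg * u]
   is [a + sg * (u + delta^2 / u)] up to terms of order [delta^2], and the
   minimum over [u] is close to [2 * delta], reached near [u = delta]. *)
Let g c u := sg * ((A.[a + sg * u] + c) / q.[a + sg * u] - a).

(** At the endpoints [delta^2] and [1 / 2] the model [u + delta^2 / u] exceeds [1] and [1 / 2],
    while its minimum [2 * delta] is at most [1 / 4]. This forces the minimum of [g c] into the
    interior. *)
Definition pole_branch_min c m :=
  (exists u, [/\ delta ^+ 2 <= u, u <= 2^-1 & g c u = m]) /\
  (forall u, delta ^+ 2 <= u -> u <= 2^-1 -> m <= g c u).

Let delta0 : 0 < delta.
Proof. by rewrite deltaE invr_gt0 mulr_gt0 // (lt_le_trans ltr01). Qed.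

Let Kdelta : K * delta = 8^-1.
Proof. by rewrite deltaE invfM mulrCA mulfV ?mulr1 // gt_eqF // (lt_le_trans ltr01). Qed.

Let delta_le : delta <= 8^-1.
Proof. by rewrite -Kdelta ler_peMl // ltW. Qed.

Let d2_gt0 : 0 < delta ^+ 2. Proof. by rewrite exprn_gt0. Qed.

Let d2_lt : delta ^+ 2 < delta.
Proof. by rewrite expr2 gtr_pMr // (le_lt_trans delta_le) // invf_lt1 // ltr1n. Qed.

Let qE u : q.[a + sg * u] = sg * u * r.[a + sg * u].
Proof. by rewrite /q hornerM !hornerE; ring. Qed.

Let r_neq0 (u : R) : 0 <= u -> u <= 2^-1 -> r.[a + sg * u] != 0.
Proof. by move=> u0 u2; have [] := rP u0 u2; rewrite -normr_gt0 => /(lt_le_trans rho0). Qed.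

Let sg0 : sg != 0.
Proof. by apply: contra_eq_neq sg2 => ->; rewrite mul0r eq_sym oner_neq0. Qed.

Let gE c (u : R) : 0 < u -> u <= 2^-1 -> g c u = u + delta ^+ 2 / u +
  (sg * delta ^+ 2 * (r^`().[a + sg * u] / r.[a + sg * u]) + c / (u * r.[a + sg * u])).
Proof.
move=> u0 u2; have r0 := r_neq0 (ltW u0) u2.
have AE : A.[a + sg * u] = (a + sg * u) * (sg * u * r.[a + sg * u]) +
    delta ^+ 2 * (r.[a + sg * u] + sg * u * r^`().[a + sg * u]).
  rewrite /A hornerD hornerM hornerX hornerZ qE /q derivM derivXsubC.
  by rewrite mul1r hornerD hornerM hornerXsubC; ring.
rewrite /g qE AE (_ : u + delta ^+ 2 / u = sg * sg * u + delta ^+ 2 / u).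
  by field; rewrite r0 sg0 (gt_eqF u0).
by rewrite sg2 mul1r.
Qed.

(** The term from [r] is at most [delta^2 * (K - 1)]. The term from [c] is at most [delta^2], since
    [u] is at least [delta^2] and [c] at most [delta^4 * rho]. The choice of [delta] makes the total
    [K * delta^2] equal to [delta / 8]. *)
Let g_bound c (u : R) : `|c| <= delta ^+ 4 * rho -> delta ^+ 2 <= u -> u <= 2^-1 ->
  `|g c u - (u + delta ^+ 2 / u)| <= delta / 8.
Proof.
move=> cs du u2; have u0 := lt_le_trans d2_gt0 du.
have [rr _ r'r] := rP (ltW u0) u2.
have r0 : 0 < `|r.[a + sg * u]| := lt_le_trans rho0 rr.
have sgn : `|sg| = 1.
  by apply/eqP; rewrite -(@eqrXn2 _ 2) // -normrX expr2 sg2 normr1 expr1n.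
rewrite gE // addrC addKr; apply: le_trans (ler_normD _ _) _.
rewrite !normrM !normfV sgn mul1r normrM (gtr0_norm u0) ger0_norm; last exact: ltW.
have -> : delta / 8 = delta ^+ 2 * (K - 1) + delta ^+ 2.
  by rewrite -Kdelta; ring.
apply: lerD.
  by rewrite ler_pM2l // ler_pdivrMr.
rewrite ler_pdivrMr ?mulr_gt0 //; apply: le_trans cs _.
rewrite (_ : delta ^+ 4 = delta ^+ 2 * delta ^+ 2); last by ring.
by rewrite -mulrA ler_pM2l // ler_pM // ltW.
Qed.

Let continuous_g c (u : R) : 0 < u -> u <= 2^-1 -> {for u, continuous (g c)}.
Proof.
move=> u0 u2; apply: cvgM; first exact: cvg_cst.
have ha p : {for u, continuous (fun v => p.[a + sg * v])}.
  have -> : (fun v => p.[a + sg * v]) = horner (p \Po (a%:P + sg *: 'X)).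
    by apply/funext => v; rewrite horner_comp !hornerE.
  exact: continuous_horner.
apply: cvgB; last exact: cvg_cst.
apply: cvgM; first by apply: cvgD; [exact: ha | exact: cvg_cst].
apply: cvgV; last exact: ha.
by rewrite qE !mulf_neq0 ?sg0 ?(gt_eqF u0) ?r_neq0 // ltW.
Qed.

Lemma pole_branch_min_exists c : `|c| <= delta ^+ 4 * rho ->
  exists m, pole_branch_min c m.
Proof.
move=> cs; have d2u : delta ^+ 2 <= 2^-1 by move: d2_lt delta_le; lra.
have [|u] := @EVT_min R (g c) _ _ d2u.
  apply: continuous_in_subspaceT => u; rewrite inE /= in_itv /= => /andP[du u2].
  by apply: continuous_g; rewrite ?(lt_le_trans d2_gt0).
rewrite in_itv /= => /andP[du u2] umin; exists (g c u); split; first by exists u.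
by move=> v dv v2; apply: umin; rewrite in_itv /= dv v2.
Qed.

Lemma pole_branch_minP c m : `|c| <= delta ^+ 4 * rho -> pole_branch_min c m ->
  [/\ 0 < m, m < 2^-1 & exists2 u, 0 <= u <= 2^-1 &
      A.[a + sg * u] + c = (a + sg * m) * q.[a + sg * u] /\
      A^`().[a + sg * u] = (a + sg * m) * q^`().[a + sg * u]].
Proof.
move=> cs [[u [du u2 gu]] gmin].
have u0 := lt_le_trans d2_gt0 du.
have d2 : delta <= 2^-1 by move: delta_le; lra.
(* Compare with [u = delta], the minimizer of the model. *)
have gd : m <= 2 * delta + delta / 8.
  have := gmin delta (ltW d2_lt) d2; have := g_bound cs (ltW d2_lt) d2.
  rewrite expr2 mulfK ?gt_eqF // ler_norml => /andP[_]; lra.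
have m2 : m < 2^-1 by move: delta_le delta0; lra.
have := g_bound cs du u2; rewrite gu ler_norml => /andP[mg _].
have sq v : 0 < v -> 2 * delta <= v + delta ^+ 2 / v.
  move=> v0; rewrite -subr_ge0.
  suff -> : v + delta ^+ 2 / v - 2 * delta = (v - delta) ^+ 2 / v.
    by rewrite divr_ge0 ?sqr_ge0 // ltW.
  by field; rewrite gt_eqF.
have m0 : 0 < m by have := sq u u0; move: delta0; lra.
have du' : delta ^+ 2 < u.
  rewrite lt_neqAle du andbT; apply/eqP => e; move: mg; rewrite -e divff ?gt_eqF //.
  by move: d2_gt0 delta_le delta0; lra.
have u2' : u < 2^-1.
  rewrite lt_neqAle u2 andbT; apply/eqP => e; move: mg; rewrite e.
  have : 0 <= delta ^+ 2 / 2^-1 by rewrite divr_ge0 // ltW.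
  by move: delta_le delta0; lra.
have hE v : 0 < v -> v <= 2^-1 -> A.[a + sg * v] + c - (a + sg * m) * q.[a + sg * v] =
    (g c v - m) * (v * r.[a + sg * v]).
  move=> v0 v2; have r0 := r_neq0 (ltW v0) v2.
  have q0 : q.[a + sg * v] != 0 by rewrite qE !mulf_neq0 ?sg0 ?(gt_eqF v0).
  have -> : v * r.[a + sg * v] = sg * q.[a + sg * v] by rewrite qE !mulrA sg2 mul1r.
  rewrite /g -[in LHS](mul1r (A.[_] + c)) -{1}sg2.
  have -> : a + sg * m = sg * sg * a + sg * m by rewrite sg2 mul1r.
  by field.
split=> //; exists u; first by rewrite (ltW u0) u2.
split; first by apply/eqP; rewrite -subr_eq0 hE // gu subrr mul0r.
(* Clearing the denominator turns [g c v - m] into a polynomial in [v]. The factor [r.[a]] makes the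
   multiplier [v * (r.[a] * r.[a + sg * v])] positive, so [p] is nonnegative on the interval and
   vanishes at [u]. *)
pose p := r.[a] *: ((A + c%:P - (a + sg * m) *: q) \Po (a%:P + sg *: 'X)).
have pE v : p.[v] = r.[a] * (A.[a + sg * v] + c - (a + sg * m) * q.[a + sg * v]).
  by rewrite /p !(hornerE, horner_comp).
have : p^`().[u] = 0.
  apply: (poly_local_min du' u2') => v dv v2; have v0 := lt_trans d2_gt0 dv.
  rewrite !pE !hE // ?(ltW v2) // gu subrr mul0r mulr0.
  have [_ rr _] := rP (ltW v0) (ltW v2).
  rewrite mulrCA (mulrCA r.[a]); apply: mulr_ge0; last by rewrite mulr_ge0 ?ltW.
  by rewrite subr_ge0 gmin // ltW.
have dp (P Q : {poly R}) (t : R) :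
    (r.[a] *: ((P + c%:P - t *: Q) \Po (a%:P + sg *: 'X)))^`().[u] =
    r.[a] * ((P^`().[a + sg * u] - t * Q^`().[a + sg * u]) * sg).
  rewrite derivZ deriv_comp !derivD derivN !derivZ !derivC derivX.
  by rewrite !(hornerE, horner_comp) /=; apply: mulr1.
rewrite /p dp => /eqP; rewrite !mulf_eq0 (negbTE sg0) orbF; have [_ + _] := rP (lexx 0) ltac:(lra).
rewrite mulr0 addr0 => rr; have /negbTE -> /= : r.[a] != 0.
  by apply: contraTneq rr => ->; rewrite mul0r ltxx.
by rewrite subr_eq0 => /eqP.
Qed.

(** For fixed [u], [g c u] is strictly monotone in [c], in the direction given by the constant sign
    of [r]. At a minimizer for [c1], [g c2] is at least [m], which orders [c1] and [c2]; exchanging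
    them gives equality. *)
Lemma pole_branch_min_inj c c' m :
  pole_branch_min c m -> pole_branch_min c' m -> c = c'.
Proof.
suff le c1 c2 : pole_branch_min c1 m -> pole_branch_min c2 m -> c1 * r.[a] <= c2 * r.[a].
  have [_ + _] := rP (lexx 0) ltac:(lra).
  rewrite mulr0 addr0 => rr; have ra0 : r.[a] != 0.
    by apply: contraTneq rr => ->; rewrite mul0r ltxx.
  by move=> H H'; apply: (mulIf ra0); apply/eqP; rewrite eq_le !le.
move=> [[u [du u2 gu]] _] [_ gmin]; have := gmin u du u2.
have u0 := lt_le_trans d2_gt0 du; have r0 := r_neq0 (ltW u0) u2.
have [_ rr _] := rP (ltW u0) u2.
rewrite -gu !gE // !lerD2l -subr_ge0 -mulrBl => H; rewrite -subr_ge0 -mulrBl.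
suff -> : (c2 - c1) * r.[a] =
    (c2 - c1) / (u * r.[a + sg * u]) * (u * (r.[a] * r.[a + sg * u])).
  apply: mulr_ge0; first exact: H.
  exact: mulr_ge0 (ltW u0) (ltW rr).
by field; rewrite r0 (gt_eqF u0).
Qed.

End CriticalValuesNearPoles.

(** * The branches at all the poles together *)

Section ManyCriticalValues.
Variable R : realType.

(** Factor by factor: [x - j] has the sign of [a - j] and absolute value at least [1 / 2], so each
    factor adds at most [2] to the logarithmic derivative. *)
Lemma prod_XsubC_near (s : seq R) (a x : R) :
  (forall j, j \in s -> 1 <= `|a - j|) -> `|x - a| <= 2^-1 ->
  let r := \prod_(j <- s) ('X - j%:P) in
  [/\ 2^-1 ^+ size s <= `|r.[x]|, 0 < r.[a] * r.[x]
    & `|r^`().[x]| <= 2 * (size s)%:R * `|r.[x]|].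
Proof.
move=> + xa; elim: s => [|j s IHs] sj /=.
  by rewrite big_nil derivC !hornerE normr1 normr0 ?mulr0n ?mulr0 ?mul0r expr0 ltr01 !lexx.
have [|r1 r2 r3] := IHs; first by move=> k ks; apply: sj; rewrite inE ks orbT.
move: r1 r2 r3; set r := \prod_(j <- s) _ => r1 r2 r3.
have aj := sj j (mem_head _ _).
have xj : 2^-1 <= `|x - j|.
  have := ler_normD (x - j) (a - x); rewrite (_ : x - j + (a - x) = a - j); last by ring.
  by rewrite (distrC a x); move: aj xa; lra.
have ajxj : 0 < (a - j) * (x - j).
  move: aj xa; rewrite [`|x - a| <= _]ler_norml => + /andP[xa1 xa2].
  case: (ger0P (a - j)) => _ aj; first by apply: mulr_gt0; lra.
  by rewrite -mulrNN; apply: mulr_gt0; lra.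
rewrite big_cons -/r derivM derivXsubC mul1r hornerD !hornerM !hornerXsubC !normrM.
split.
- by rewrite exprS ler_pM.
- by rewrite mulrACA mulr_gt0.
- apply: le_trans (ler_normD _ _) _; rewrite normrM -natr1.
  have H : `|x - j| * `|r^`().[x]| <= `|x - j| * (2 * (size s)%:R * `|r.[x]|).
    by rewrite ler_wpM2l.
  apply: le_trans (lerD (lexx _) H) _.
  have : `|r.[x]| <= 2 * `|x - j| * `|r.[x]|.
    by rewrite ler_peMl //; move: xj; lra.
  by lra.
Qed.

Lemma many_critical_values n :
  exists (A q : {poly R}) (eta : R) (T : R -> nat -> bool -> R),
  [/\ 0 < eta, size A = n.+2, size q = n.+1 & coprimep q q^`()] /\
  (forall c i s, `|c| <= eta -> (i < n)%N -> exists2 x, 0 < x &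
     A.[x] + c = T c i s * q.[x] /\ A^`().[x] = T c i s * q^`().[x]) /\
  (forall c c' i i' s s', `|c| <= eta -> `|c'| <= eta -> (i < n)%N -> (i' < n)%N ->
     T c i s = T c' i' s' -> [/\ c = c', i = i' & s = s']).
Proof.
pose K : R := 2 * n%:R + 1; pose delta := (8 * K)^-1; pose rho : R := 2^-1 ^+ n.
pose sg (s : bool) : R := (-1) ^+ s.
have K1 : 1 <= K by rewrite lerDr mulr_ge0.
have delta0 : 0 < delta by rewrite invr_gt0 mulr_gt0 // (lt_le_trans ltr01).
have rho0 : 0 < rho by rewrite exprn_gt0.
have sg2 s : sg s * sg s = 1 by rewrite -expr2 sqrr_sign.
(* Nodes starting at [1] keep every critical point, at distance at most [1 / 2] from its node,
   positive and hence in the torus. *)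
pose nodes := [seq j.+1%:R : R | j <- iota 0 n].
pose q : {poly R} := \prod_(j <- nodes) ('X - j%:P).
pose A : {poly R} := 'X * q + delta ^+ 2 *: q^`().
pose others i := [seq j.+1%:R : R | j <- rem i (iota 0 n)].
pose r i : {poly R} := \prod_(j <- others i) ('X - j%:P).
have qE i : (i < n)%N -> q = ('X - i.+1%:R%:P) * r i.
  move=> ilt; have iI : i \in iota 0 n by rewrite mem_iota.
  by rewrite /q /nodes /r /others !big_map (perm_big _ (perm_to_rem iI)) big_cons.
have rP i s : (i < n)%N -> forall u : R, 0 <= u -> u <= 2^-1 ->
  [/\ rho <= `|(r i).[i.+1%:R + sg s * u]|,
      0 < (r i).[i.+1%:R] * (r i).[i.+1%:R + sg s * u]
    & `|(r i)^`().[i.+1%:R + sg s * u]| <= (K - 1) * `|(r i).[i.+1%:R + sg s * u]|].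
  move=> ilt u u0 u2; have iI : i \in iota 0 n by rewrite mem_iota.
  have so : (size (others i) <= n)%N.
    by rewrite size_map size_rem // size_iota leq_pred.
  have [||r1 r2 r3] := @prod_XsubC_near (others i) i.+1%:R (i.+1%:R + sg s * u).
  - move=> _ /mapP[j + ->]; rewrite mem_rem_uniq ?iota_uniq // inE => /andP[ji _].
    rewrite -[i.+1%:R]/(i.+1%:Z%:~R) -[j.+1%:R]/(j.+1%:Z%:~R) -rmorphB /= -intr_norm.
    rewrite -[1]/(1%:~R) ler_int; move: ji; lia.
  - by rewrite addrAC subrr add0r normrM normrX normrN1 expr1n mul1r ger0_norm.
  split=> //.
    apply: le_trans r1; rewrite /rho ler_wiXn2l //; lra.
  apply: le_trans r3 _; rewrite /K addrK ler_wpM2r // ler_wpM2l // ler_nat //.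
pose mins (k : R * nat * bool) :=
  pole_branch_min k.1.2.+1%:R (sg k.2) delta (r k.1.2) k.1.1.
pose eta := delta ^+ 4 * rho.
have [m mP] : {m & forall k : R * nat * bool,
    `|k.1.1| <= eta -> (k.1.2 < n)%N -> mins k (m k)}.
  apply: (@boolp.choice _ _ (fun k x => `|k.1.1| <= eta -> (k.1.2 < n)%N -> mins k x)).
  move=> [[c i] s] /=.
  have [[ce ilt]|N] := pselect (`|c| <= eta /\ (i < n)%N).
    have [m mP] := pole_branch_min_exists (sg2 s) rho0 K1 erefl (rP i s ilt) ce.
    by exists m.
  by exists 0 => ce ilt; case: N.
have mB c i s (ce : `|c| <= eta) (ilt : (i < n)%N) := pole_branch_minP
  (sg2 s) rho0 K1 erefl (rP i s ilt) ce (mP (c, i, s) ce ilt).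
exists A, q, eta, (fun c i s => i.+1%:R + sg s * m (c, i, s)); split; last split.
- have sq : size q = n.+1 by rewrite size_prod_XsubC size_map size_iota.
  have q0 : q != 0 by rewrite -size_poly_gt0 sq.
  split=> //; first by rewrite mulr_gt0 // exprn_gt0.
    rewrite size_polyDl mulrC size_mulX ?sq //.
    rewrite (leq_ltn_trans (size_scale_leq _ _)) //.
    by rewrite (ltn_trans (lt_size_deriv q0)) ?sq.
  have : uniq nodes.
    by rewrite map_inj_uniq ?iota_uniq // => j k /eqP; rewrite eqr_nat eqSS => /eqP.
  by rewrite -separable_prod_XsubC separable_poly.unlock.
- move=> c i s ce ilt; have [m0 m2 [u /andP[u0 u2] [e1 e2]]] := mB c i s ce ilt.
  exists (i.+1%:R + sg s * u); last by rewrite /A (qE i ilt).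
  have : 1 <= i.+1%:R :> R by rewrite ler1n.
  by rewrite /sg; case: s {m0 m2 e1 e2} => /=; rewrite ?expr0 ?expr1; lra.
- move=> c c' i i' s s' ce ce' ilt ilt' E.
  have [m0 m2 _] := mB c i s ce ilt; have [m0' m2' _] := mB c' i' s' ce' ilt'.
  (* Both values are within [1 / 2] of their integer nodes, so the nodes differ by less than [1]. *)
  have ii : i = i'.
    have : `|i.+1%:R - i'.+1%:R| < 1 :> R.
      rewrite ltr_norml; move: E m0 m2 m0' m2'; rewrite /sg.
      move: (m _) (m _) => x x'.
      by case: (s); case: (s'); rewrite ?expr0 ?expr1 => *; apply/andP; split; lra.
    rewrite -[i.+1%:R]/(i.+1%:Z%:~R) -[i'.+1%:R]/(i'.+1%:Z%:~R) -rmorphB /= -intr_norm.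
    rewrite -[1]/(1%:~R) ltr_int; lia.
  have ss : s = s'.
    move: E m0 m0'; rewrite ii => /addrI; rewrite /sg.
    move: (m _) (m _) => x x'.
    by case: (s); case: (s'); rewrite // ?expr0 ?expr1; lra.
  split=> //; move: (mP (c, i, s) ce ilt) (mP (c', i', s') ce' ilt'); rewrite /mins /=.
  move: E; rewrite -ii -ss => /addrI/(mulfI _) <-; last first.
    by rewrite /sg signr_eq0.
  exact: pole_branch_min_inj (sg2 s) rho0 K1 erefl (rP i s ilt) _ _ _.
Qed.

End ManyCriticalValues.

(** * Genericity and counting in a pencil *)

Section Pencils.
Variable R : realType.
Local Notation C := R[i].
Implicit Types (f P Q : laurent R) (A : set 'cV[R]_3).

Lemma singular_polyZ (c : C) f : c != 0 -> singular_poly (c *: f) <-> singular_poly f.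
Proof.
have W (d : C) g : singular_poly g -> singular_poly (d *: g).
  move=> /singular_polyP[x [xT gx dgx]]; apply/singular_polyP; exists x.
  by split=> // [|k]; rewrite laurent_sumZ ?gx ?dgx mulr0.
by move=> c0; split=> [/(W c^-1)|/W//]; rewrite scalerA mulVf // scale1r.
Qed.

Lemma surfaceZ (c : C) f : c != 0 -> surface (c *: f) = surface f.
Proof.
move=> c0; apply/seteqP; split=> [_ [d d0 <-]|_ [d d0 <-]] /=.
  by exists (d * c); rewrite /= ?mulf_neq0 // scalerA.
by exists (d / c); rewrite /= ?mulf_neq0 ?invr_eq0 // scalerA divfK.
Qed.

Lemma surface_refl f : surface f f.
Proof. by exists 1; rewrite /= ?oner_neq0 // scale1r. Qed.

(** The affine parameter misses a single member, the surface of [Q]. *)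
Lemma generic_pencil_affine P Q :
  finite_set [set t : C | singular_poly (P - t *: Q)] -> generic_pencil (pencil P Q).
Proof.
move=> fin; pose F : set (set (laurent R)) :=
  [set surface Q] `|` [set surface (P - t *: Q) | t in [set t | singular_poly (P - t *: Q)]].
apply: (@sub_finite_set _ _ F); last first.
  by rewrite finite_setU; split; [exact: finite_set1 | exact: finite_image].
move=> S [[a [b [ab ->]]] [f [c c0 <-]]]; rewrite singular_polyZ // => sing.
have [a0|a0] := eqVneq a 0.
  left; move: ab; rewrite a0 scale0r add0r => ab; rewrite surfaceZ //.
  by apply: contraNneq ab => ->.
have E : a *: P + b *: Q = a *: (P - (- b / a) *: Q).
  by rewrite scalerBr scalerA mulrCA divff // mulr1 scaleNr opprK.
by right; rewrite E surfaceZ //; exists (- b / a) => //; move: sing; rewrite E singular_polyZ.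
Qed.

Lemma lin_indep_surface_inj P Q (s t : C) : lin_indep P Q ->
  surface (P - s *: Q) = surface (P - t *: Q) -> s = t.
Proof.
move=> PQ st; have : surface (P - t *: Q) (P - s *: Q) by rewrite -st; exact: surface_refl.
move=> [c c0 e].
have /PQ[c1 cts] : (c - 1) *: P + (s - c * t) *: Q = 0.
  apply/eqP/freeg_eqP => m; have := congr1 (coeff m) e.
  rewrite !(coeffD, coeffN, coeffZ, coeff0) => /eqP; rewrite -subr_eq0 => /eqP <-.
  by ring.
have c1' : c = 1 by apply/eqP; rewrite -subr_eq0 c1.
by apply/eqP; rewrite -subr_eq0 -cts c1' mul1r.
Qed.

Definition pencil_with_real_singular_members A N :=
  exists L : set (set (laurent R)), [/\ real_pencil A L, generic_pencil L &
    (`I_N #<= L `&` [set S | real_surface S /\ singular_surface S])%card].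

Lemma pencil_of_real_parameters A P Q (ts : seq R) :
  supported A P -> supported A Q -> real_poly P -> real_poly Q -> lin_indep P Q ->
  finite_set [set t : C | singular_poly (P - t *: Q)] -> uniq ts ->
  (forall t, t \in ts -> singular_poly (P - (real_complex R t) *: Q)) ->
  pencil_with_real_singular_members A (size ts).
Proof.
move=> sP sQ rP rQ PQ fin uts sing; exists (pencil P Q); split.
- by exists P, Q.
- exact: generic_pencil_affine.
pose F k := surface (P - (real_complex R (nth 0 ts k)) *: Q).
have Finj : {in `I_(size ts) &, injective F}.
  move=> j k; rewrite !inE /= => jlt klt /(lin_indep_surface_inj PQ)/complexI/eqP.
  by rewrite nth_uniq // => /eqP.
rewrite -(card_le_eql (inj_card_eq Finj)); apply: subset_card_le => _ [k klt <-].
split; first by exists 1, (- real_complex R (nth 0 ts k));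
  rewrite xpair_eqE oner_eq0 scale1r scaleNr.
split; exists (P - (real_complex R (nth 0 ts k)) *: Q); try exact: surface_refl.
  move=> m; rewrite coeffB coeffZ rpredB ?rP // rpredM ?rQ //.
  by apply/complex_realP; exists (nth 0 ts k).
by apply: sing; rewrite mem_nth.
Qed.

Lemma finite_roots (p : {poly C}) : p != 0 -> finite_set [set x | root p x].
Proof.
move=> p0; have [r pE] := closed_field_poly_normal p.
apply: (@sub_finite_set _ _ [set` r]); last by apply/finite_seqP; exists r.
by move=> x /=; rewrite pE rootZ ?lead_coef_eq0 // root_prod_XsubC.
Qed.

(** A singular point has [y] and [z] among the roots of the derivatives of [B] and [D], and [x]
    among the roots of the nonzero polynomial [W c]. The point determines [t]: through the equation
    if [q.[x]] is nonzero, and otherwise through its derivative, because [q] has simple roots. *)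
Lemma finite_singular_parameters (A B D q : {poly C}) :
  coprimep q q^`() -> (1 < size A)%N -> (size q < size A)%N ->
  B^`() != 0 -> D^`() != 0 ->
  finite_set [set t : C | singular_poly (separated A B D - t *: axis_laurent 0 q)].
Proof.
move=> qq' A1 qA B0 D0.
have q0 : q != 0.
  by apply: contraTneq qq' => ->; rewrite deriv0 coprimep0 eqp_sym eqp0 oner_eq0.
pose W c := A^`() * q - (A + c%:P) * q^`().
have W0 c : W c != 0.
  have sAc : size (A + c%:P) = size A.
    by rewrite size_polyDl // (leq_ltn_trans (size_polyC_leq1 _)).
  have := @wronskian_neq0 C (A + c%:P) q; rewrite derivD derivC addr0; apply=> //.
    by rewrite -size_poly_gt0 sAc ltnW.
  by rewrite sAc gtn_eqF.
pose F (c x : C) : set C := [set (A.[x] + c) / q.[x]] `|` [set A^`().[x] / q^`().[x]].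
pose T := \bigcup_(y in [set y | root B^`() y]) \bigcup_(z in [set z | root D^`() z])
  \bigcup_(x in [set x | root (W (B.[y] + D.[z])) x]) F (B.[y] + D.[z]) x.
apply: (@sub_finite_set _ _ T); last first.
  apply: bigcup_finite => [|y _]; first exact: finite_roots.
  apply: bigcup_finite => [|z _]; first exact: finite_roots.
  apply: bigcup_finite => [|x _]; first exact: (finite_roots (W0 _)).
  by rewrite finite_setU; split; exact: finite_set1.
move=> t /=; rewrite -[separated _ _ _]scale1r -scaleNr => /singular_separatedP.
move=> [x [y [z [_ []]]]]; rewrite !mul1r => e0 e1 /eqP e2 /eqP e3.
have {}e0 : A.[x] + (B.[y] + D.[z]) = t * q.[x].
  by apply/eqP; rewrite -subr_eq0 addrA -mulNr e0.
have {}e1 : A^`().[x] = t * q^`().[x] by apply/eqP; rewrite -subr_eq0 -mulNr e1.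
exists y => //; exists z => //; exists x.
  rewrite /= /root /W !(hornerM, hornerD, hornerN) hornerC e0 e1.
  by rewrite subr_eq0 mulrAC.
have [qx|qx] := eqVneq q.[x] 0; last by left; rewrite /= e0 mulfK.
right; rewrite /= e1 mulfK //; apply/negP => q'x.
by have := coprimep_root qq' (introT eqP qx : root q x); rewrite q'x.
Qed.

End Pencils.

(** * The pencil of degree [n + 1] *)

Section PencilOfDegree.
Variable R : realType.
Local Notation C := R[i].
Local Notation toC := (real_complex R).

Lemma axis_exponentE k l (i : nat) :
  (delta_mx k 0 *+ i : 'cV[int]_3) l 0 = if l == k then i%:Z else 0.
Proof. by rewrite mulmxnE mxE andbT; case: eqP => _; rewrite ?mul0rn // -natz. Qed.

Lemma axis_coef0 (p : {poly C}) (j : nat) :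
  laurent_sum (fun m => (m 0 0 == j%:Z)%:R) (axis_laurent 0 p) = p`_j.
Proof.
rewrite laurent_sum_axis.
under eq_bigr => i _ do rewrite axis_exponentE eqxx eqz_nat.
have [jlt|jge] := ltnP j (size p); last first.
  rewrite nth_default // big1 // => i _.
  by rewrite (ltn_eqF (leq_trans (ltn_ord i) jge)) mulr0.
rewrite (bigD1 (Ordinal jlt)) //= eqxx mulr1 big1 ?addr0 // => i ij.
by rewrite (_ : (i == j :> nat) = false) ?mulr0 //; apply/negbTE.
Qed.

(** The degree is [j.+1] because exponents on another axis have first coordinate [0]. *)
Lemma axis_coef_neq0 (p : {poly C}) k (j : nat) : k != 0 ->
  laurent_sum (fun m => (m 0 0 == j.+1%:Z)%:R) (axis_laurent k p) = 0.
Proof.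
move=> k0; rewrite laurent_sum_axis big1 // => i _.
by rewrite axis_exponentE [0 == k]eq_sym (negbTE k0) mulr0.
Qed.

Lemma lin_indep_separated (A B D q : {poly C}) : (1 < size A)%N ->
  (size q < size A)%N -> q != 0 -> lin_indep (separated A B D) (axis_laurent 0 q).
Proof.
move=> A1 qA q0 a b E.
have a0 : a = 0.
  (* The degree of [A] is written as a successor so that the other two axes contribute nothing; [q]
     has smaller degree, so only the leading coefficient of [A] remains. *)
  have := congr1 (laurent_sum (fun m => (m 0 0 == (size A).-2.+1%:Z)%:R)) E.
  have sA : (size A).-2.+1 = (size A).-1 by case: (size A) A1 => [|[]].
  rewrite raddfD /= !laurent_sumZ !raddfD /= !axis_coef0 !axis_coef_neq0 // !addr0 raddf0.
  rewrite [q`_ _]nth_default ?sA; last by case: (size A) qA.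
  rewrite mulr0 addr0 => /eqP; rewrite mulf_eq0 -lead_coefE lead_coef_eq0.
  by rewrite -size_poly_eq0; case: (size A) A1 => [//|k] _ /orP[/eqP|].
split=> //; move: E; rewrite a0 scale0r add0r.
move=> /(congr1 (laurent_sum (fun m => (m 0 0 == (size q).-1%:Z)%:R))).
rewrite laurent_sumZ axis_coef0 raddf0 => /eqP.
by rewrite mulf_eq0 -lead_coefE lead_coef_eq0 (negbTE q0) orbF => /eqP.
Qed.

Lemma laurent_pencil_of_degree n : exists (P Q : laurent R) (ts : seq R),
  [/\ real_poly P, real_poly Q, lin_indep P Q
    & finite_set [set t : C | singular_poly (P - t *: Q)]] /\
  [/\ size ts = (2 * n ^ 3)%N, uniq ts,
      forall t, t \in ts -> singular_poly (P - toC t *: Q)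
    & forall m, m \in dom P \/ m \in dom Q ->
        (forall k, 0 <= m k 0) /\ \sum_k m k 0 <= n.+1%:Z].
Proof.
have [A [q [eta [T [[eta0 sA sq qq'] [TP T_inj]]]]]] := many_critical_values R n.
have [B [D [y [z [[sB sD] [B0 D0] yzP cP c_inj]]]]] := small_distinct_critical_sums n eta0.
pose c i j := B.[y i] + D.[z j].
pose I : finType := ('I_n * 'I_n * 'I_n * bool)%type.
pose t (u : I) := T (c u.1.1.1 u.1.1.2) u.1.2 u.2.
have t_inj : injective t.
  move=> [[[i j] k] s] [[[i' j'] k'] s'] /T_inj[] //; rewrite ?cP //= /c.
  by move=> /c_inj[] // /val_inj -> /val_inj -> /val_inj -> ->.
have q0 : q != 0 by rewrite -size_poly_gt0 sq.
pose f := map_poly toC.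
have smap p : size (f p) = size p by rewrite size_map_poly.
exists (separated (f A) (f B) (f D)), (axis_laurent 0 (f q)), [seq t u | u : I].
have realf k p : real_poly (axis_laurent k (f p)).
  by apply: real_axis => i; rewrite coef_map; apply/complex_realP; exists p`_i.
have realD (g h : laurent R) : real_poly g -> real_poly h -> real_poly (g + h).
  by move=> gr hr m; rewrite coeffD rpredD ?gr ?hr.
split; split.
- by apply: (realD); [apply: (realD)|]; apply: realf.
- exact: realf.
- by apply: lin_indep_separated; rewrite ?map_poly_eq0 // !smap sA ?sq.
- by apply: finite_singular_parameters;
    rewrite ?deriv_map ?coprimep_map ?map_poly_eq0 // !smap sA ?sq.
- rewrite size_image !card_prod !card_ord card_bool mulnC.
  by rewrite !expnS expn0 muln1; lia.
- by rewrite map_inj_uniq // enum_uniq.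
- move=> _ /mapP[[[[i j] k] s] _ ->].
  have [x x0 [e0 e1]] := TP _ _ s (cP _ _ (ltn_ord i) (ltn_ord j)) (ltn_ord k).
  have [yi0 By _ _] := yzP _ (ltn_ord i); have [_ _ zj0 Dz] := yzP _ (ltn_ord j).
  rewrite -[separated _ _ _]scale1r -scaleNr; apply/singular_separatedP.
  have toC0 w : 0 < w -> toC w != 0 by move=> w0; rewrite fmorph_eq0 gt_eqF.
  exists (toC x), (toC (y i)), (toC (z j)); split; first by split; apply: toC0.
  rewrite !deriv_map !horner_map By Dz rmorph0 !mul1r; split=> //.
    by rewrite -!rmorphD /= -(addrA A.[x]) e0 -rmorphN -rmorphM -rmorphD /= mulNr subrr rmorph0.
  by rewrite e1 -rmorphN -rmorphM -rmorphD /= mulNr subrr rmorph0.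
- have axisP k (p : {poly R}) m : (size p <= n.+2)%N -> m \in dom (axis_laurent k (f p)) ->
      (forall l, 0 <= m l 0) /\ \sum_l m l 0 <= n.+1%:Z.
    move=> sp mp; case: (dom_axis mp) => i; rewrite smap => ilt ->; split=> [l|].
      by rewrite axis_exponentE; case: ifP.
    rewrite (bigD1 k) //= axis_exponentE eqxx big1 ?addr0 ?lez_nat.
      by rewrite -ltnS (leq_trans ilt).
    by move=> l /negbTE lk; rewrite axis_exponentE lk.
  move=> m [|]; last by apply: axisP; rewrite sq.
  move=> /domD_subset; rewrite mem_cat => /orP[/domD_subset|].
    by rewrite mem_cat => /orP[]; apply: axisP; rewrite ?sA.
  exact: axisP.
Qed.

End PencilOfDegree.

(** * Transport into the dilates of [Delta] *)

Section PencilsInDilates.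
Variable R : realType.
Local Notation C := R[i].
Variables (Delta : set 'cV[R]_3).

Lemma pencil_in_dilate (lambda : R) (M : 'M[int]_3) (v : 'cV[R]_3) (d n : nat) :
  M \in unitmx -> 0 < lambda ->
  [set lambda *: (map_mx intr M *m x) + v | x in @std_simplex R] `<=` Delta ->
  (0 < d)%N -> n.+1%:R + 3 <= d%:R * lambda ->
  pencil_with_real_singular_members (dilate d Delta) (2 * n ^ 3).
Proof.
move=> Mu l0 sD d0 nd.
have [w wP] := dilated_lattice_simplex Mu l0 sD d0 nd.
have [P [Q [ts [[rP rQ PQ fin] [sts uts sing domP]]]]] := laurent_pencil_of_degree R n.
pose h := affine_map M w.
have sh t : reindex_laurent h P - t *: reindex_laurent h Q = reindex_laurent h (P - t *: Q).
  have -> : P - t *: Q = - t *: Q + P by rewrite scaleNr addrC.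
  by rewrite reindex_laurent_is_linear scaleNr addrC.
rewrite -sts; apply: (@pencil_of_real_parameters _ _ (reindex_laurent h P) (reindex_laurent h Q)) => //.
- move=> _ /dom_reindex_laurent[m mP ->]; have [m0 me] := domP m (or_introl mP).
  exact: wP.
- move=> _ /dom_reindex_laurent[m mQ ->]; have [m0 me] := domP m (or_intror mQ).
  exact: wP.
- exact: real_reindex_laurent.
- exact: real_reindex_laurent.
- move=> a b e; apply: PQ; apply: (can_inj (reindex_laurentK (affine_mapK w Mu))).
  by rewrite -[b *: Q]addr0 !reindex_laurent_is_linear raddf0 addr0.
- apply: sub_finite_set fin => t /=; rewrite sh.
  by move/(singular_reindex w _ Mu).
- by move=> t /sing; rewrite sh => /(singular_reindex w _ Mu).
Qed.

(* The logarithmic derivatives of [x^m - t * x^m'] vanish together only if [m = m']. *)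
Lemma monomial_pencil_in_dilate (d : nat) :
  lattice_polytope Delta -> three_dimensional Delta -> (0 < d)%N ->
  pencil_with_real_singular_members (dilate d Delta) 0.
Proof.
move=> DL D3 d0; have [m [m' [mm' Dm Dm']]] := two_lattice_points DL D3.
have mm'd : m *+ d != m' *+ d.
  apply: contra mm' => /eqP/matrixP E; apply/eqP/matrixP => k j; move: (E k j).
  by rewrite !mulmxnE => /(pmulrnI d0).
pose X a : laurent R := << 1 *g a >>.
have sX a : Delta (lattice_point R a) -> supported (dilate d Delta) (X (a *+ d)).
  move=> Da b; rewrite domU ?oner_neq0 // inE => /eqP ->.
  by exists (lattice_point R a); rewrite ?lattice_pointMn.
have rX a : real_poly (X a) by move=> b; rewrite coeffU mul1r realn.
apply: (@pencil_of_real_parameters _ _ (X (m *+ d)) (X (m' *+ d)) [::]) => //.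
- exact: sX.
- exact: sX.
- move=> a b E; have := congr1 (coeff (m *+ d)) E; have := congr1 (coeff (m' *+ d)) E.
  rewrite !coeffD !coeffZ !coeffU !coeff0 !eqxx (negbTE mm'd) eq_sym (negbTE mm'd).
  by rewrite !mulr1 !mulr0 addr0 add0r => -> ->.
- apply: (@sub_finite_set _ _ set0) => // t /= /singular_polyP[x [xT x0 dx]].
  move/eqP: mm'd; apply; apply/matrixP => k j; rewrite ord1.
  have := dx k; move: x0; rewrite !raddfB /= !laurent_sumZ !laurent_sumU !mul1r.
  move=> /subr0_eq e; rewrite mulrCA -e -mulrBl => /eqP.
  by rewrite mulf_eq0 (negbTE (monomial_neq0 _ xT)) orbF subr_eq0 eqr_int => /eqP.
Qed.

End PencilsInDilates.

Theorem theorem5p3 (R : realType) (Delta : set 'cV[R]_3)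
    (hDelta : lattice_polytope Delta) (hdim : three_dimensional Delta) :
  exists r : nat -> R,
    r =o_\oo (fun d : nat => d%:R ^+ 3 : R) /\
    forall d : nat, (1 <= d)%N ->
      exists L : set (set (laurent R)),
        [/\ real_pencil (dilate d Delta) L, generic_pencil L
          & exists n : nat,
              3 / 2 * alpha Delta ^+ 3 * d%:R ^+ 3 + r d <= n%:R /\
              (`I_n #<= L `&` [set S | real_surface S /\ singular_surface S])%card].
Proof.
have fallback d : (1 <= d)%N -> pencil_with_real_singular_members (dilate d Delta) 0.
  exact: monomial_pencil_in_dilate.
(* If [alpha Delta] is not positive, neither is the required count, and any generic real pencil will
   do with [r = 0]. *)
have [alpha_le0|alpha_gt0] := lerP (alpha Delta) 0.
  exists (fun=> 0); split.
    by apply/eqoP => eps eps0; exists 0%N => // d _; rewrite normr0 mulr_ge0 // ltW.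
  move=> d d1; have [L [rL gL cL]] := fallback d d1; exists L; split=> //.
  exists 0%N; split=> //; rewrite addr0 mulr_le0_ge0 ?exprn_ge0 // mulr_ge0_le0 //.
  by rewrite exprS mulr_le0_ge0 // sqr_ge0.
have [lambda [lambda0 [M [v [Mu sD]]]] lambda_gt] :
    exists2 lambda : R, 0 < lambda /\ exists (M : 'M[int]_3) (v : 'cV[R]_3),
      M \in unitmx /\
      [set lambda *: (map_mx intr M *m x) + v | x in @std_simplex R] `<=` Delta
    & 19 / 20 * alpha Delta < lambda.
  have sE : has_sup [set lambda : R | 0 < lambda /\ exists (M : 'M[int]_3) (v : 'cV[R]_3),
      M \in unitmx /\
      [set lambda *: (map_mx intr M *m x) + v | x in @std_simplex R] `<=` Delta].
    (* [sup] has the default value [0] on a set without a supremum, which positivity excludes. *)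
    apply: contrapT => /sup_out; rewrite -/(alpha Delta) => E.
    by move: alpha_gt0; rewrite E ltxx.
  have e0 : 0 < alpha Delta / 20 by rewrite divr_gt0.
  have [lambda lP lgt] := sup_adherent e0 sE; exists lambda => //.
  by move: lgt; rewrite -/(alpha Delta); lra.
(* For small [d] this cancels the main term; it vanishes from some [d] on, hence is [o(d^3)]. *)
pose r (d : nat) : R := if alpha Delta * d%:R < 200 then
  - (3 / 2 * alpha Delta ^+ 3 * d%:R ^+ 3) else 0.
exists r; split.
  apply/eqoP => eps eps0; exists (Num.truncn (200 / alpha Delta)).+1 => // d /= Nd.
  rewrite /r ifF ?normr0 ?mulr_ge0 // ?ltW //; apply/negbTE; rewrite -leNgt mulrC.
  rewrite -ler_pdivrMr //; apply: le_trans (_ : _ <= (Num.truncn (200 / alpha Delta)).+1%:R) _.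
    by rewrite ltW // truncnS_gt.
  by rewrite ler_nat.
move=> d d1; have [small|big] := ltP (alpha Delta * d%:R) 200.
  have [L [rL gL cL]] := fallback d d1; exists L; split=> //.
  by exists 0%N; split=> //; rewrite /r small subrr.
pose s := alpha Delta * d%:R.
have ls : 19 / 20 * s <= d%:R * lambda.
  by rewrite /s mulrA mulrC ler_wpM2l // ltW.
(* The [4] is [1] for the degree [n + 1] and [3] for the rounding. Truncation gives
   [n > d * lambda - 5 >= 19 / 20 * s - 5], which exceeds [11 / 12 * s] because [s / 30 > 5] when
   [s >= 200]. *)
pose n := Num.truncn (d%:R * lambda - 4).
have ge0 : 0 <= d%:R * lambda - 4 by move: big ls; rewrite -/s; lra.
have /andP[nle nlt] := truncn_itv ge0.
have nd : n.+1%:R + 3 <= d%:R * lambda by move: nle; rewrite -/n -natr1; lra.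
have [L [rL gL cL]] := pencil_in_dilate Mu lambda0 sD d1 nd; exists L; split=> //.
exists (2 * n ^ 3)%N; split=> //; rewrite /r ltNge big addr0 natrM natrX -mulrA -exprMn -/s.
(* [2 * (11 / 12)^3 > 3 / 2] *)
have ns : 11 / 12 * s <= n%:R by move: nlt ls big; rewrite -/n -/s -natr1; lra.
have s0 : 0 <= s by move: big; rewrite -/s; lra.
(* [5 / 6] is slightly below the square of [11 / 12], and [2 * 5 / 6 * 11 / 12 = 55 / 36] still
   exceeds [3 / 2]. *)
have s2 : 5 / 6 * s ^+ 2 <= n%:R ^+ 2.
  have := ler_pM (mulr_ge0 _ s0) (mulr_ge0 _ s0) ns ns; rewrite !divr_ge0 // => /(_ isT isT).
  by have := exprn_ge0 2 s0; lra.
have := ler_pM (mulr_ge0 _ (exprn_ge0 2 s0)) (mulr_ge0 _ s0) s2 ns.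
rewrite !divr_ge0 // => /(_ isT isT).
by have := exprn_ge0 3 s0; lra.
Qed.
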